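(* For every positive integer $n$, the lion number of the triangular grid graph $T_n$ satisfies \[ \frac{n}{2\sqrt{2}}<l(T_n)\le n+1 . \]
   Context: The triangular grid graph $T_n$ has vertex set $\{(v_1,v_2)\in\mathbb{Z}_{\ge 0}^2 : v_1+v_2\le n\}$, and two vertices are adjacent iff they are of the form $(a,b),(a+1,b)$, or $(a,b),(a,b+1)$, or $(a+1,b),(a,b+1)$. Lions and Contamination game on a graph $G$ with $\ell$ lions: the lions are placed on vertices; initially every vertex not occupied by a lion is contaminated. In each turn every lion simultaneously either stays at its vertex or moves along an edge to an adjacent vertex, and simultaneously the contamination spreads: after the turn, a vertex $v$ is contaminated iff $v$ is not occupied by a lion after the turn and either $v$ was contaminated before the turn, or $v$ has a neighbor $u$ that was contaminated before the turn such that no lion traversed the edge $uv$ during this turn. (Thus contamination moves along edges, cannot pass through an edge used by a lion in that turn, and may recontaminate previously cleared vertices.) A winning strategy is a finite sequence of lion moves after which no vertex is contaminated. The lion number $l(G)$ is the minimum number of lions for which a winning strategy exists. *)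

(* Defs.v *)
From mathcomp Require Import all_boot all_order all_algebra.
From mathcomp Require Import boolp reals.

Set Implicit Arguments.
Unset Strict Implicit.
Unset Printing Implicit Defensive.

Section LionsAndContamination.

(* A graph is an adjacency relation on a finite type of vertices. *)
Variables (V : finType) (adj : rel V).

(* Several lions may share a vertex. *)
Definition placement (l : nat) := {ffun 'I_l -> V}.

Definition occupied (l : nat) (p : placement l) : {set V} :=
  [set v | [exists i, p i == v]].

Definition legal_turn (l : nat) : rel (placement l) := fun p q =>
  [forall i, (q i == p i) || adj (p i) (q i)].

(* The edge uv is blocked by a lion that traverses it in either direction. *)
Definition traversed (l : nat) (p q : placement l) (u v : V) : bool :=
  [exists i, ((p i == u) && (q i == v)) || ((p i == v) && (q i == u))].

Definition initial_contamination (l : nat) (p : placement l) : {set V} :=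
  ~: occupied p.

Definition spread (l : nat) (p q : placement l) (C : {set V}) : {set V} :=
  [set v | (v \notin occupied q) &&
    ((v \in C) ||
     [exists u, [&& adj u v, u \in C & ~~ traversed p q u v]])].

Fixpoint contamination_after (l : nat) (p : placement l) (C : {set V})
    (moves : seq (placement l)) : {set V} :=
  if moves is q :: moves' then contamination_after q (spread p q C) moves'
  else C.

(* The sequence lists the placements reached after each successive turn. *)
Definition winning_strategy (l : nat) (p : placement l)
    (moves : seq (placement l)) : Prop :=
  path (@legal_turn l) p moves /\
  contamination_after p (initial_contamination p) moves = set0.

Definition lions_win (l : nat) : Prop :=
  exists (p : placement l) (moves : seq (placement l)),
    winning_strategy p moves.

Lemma lions_win_card : lions_win #|V|.
Proof.
exists [ffun i => enum_val i], [::]; split=> //=.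
apply/setP=> v; rewrite !inE; apply/negbTE; rewrite negbK.
by apply/existsP; exists (enum_rank v); rewrite ffunE enum_rankK.
Qed.

Lemma ex_lions_win : exists l, `[< lions_win l >].
Proof. by exists #|V|; apply/asboolP; exact: lions_win_card. Qed.

Definition lion_number : nat := ex_minn ex_lions_win.

Lemma lion_numberP :
  lions_win lion_number /\ forall l, lions_win l -> lion_number <= l.
Proof.
rewrite /lion_number; case: ex_minnP => m /asboolP wm min_m.
by split=> // l wl; apply: min_m; apply/asboolP.
Qed.

End LionsAndContamination.

Definition tri_vertex (n : nat) : finType :=
  {v : 'I_n.+1 * 'I_n.+1 | v.1 + v.2 <= n}.

(* One orientation of each edge: (a,b)(a+1,b), (a,b)(a,b+1), (a+1,b)(a,b+1). *)
Definition tri_arc (n : nat) : rel (tri_vertex n) := fun u v =>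
  let: (u1, u2) := val u in let: (v1, v2) := val v in
  [|| (v1 == u1.+1 :> nat) && (v2 == u2 :> nat),
      (v1 == u1 :> nat) && (v2 == u2.+1 :> nat)
    | (u1 == v1.+1 :> nat) && (v2 == u2.+1 :> nat)].

Definition tri_grid (n : nat) : rel (tri_vertex n) := fun u v =>
  tri_arc u v || tri_arc v u.

Lemma tri_grid_sym (n : nat) : symmetric (@tri_grid n).
Proof. by move=> u v; rewrite /tri_grid orbC. Qed.

Lemma tri_grid_irrefl (n : nat) : irreflexive (@tri_grid n).
Proof.
move=> u; rewrite /tri_grid orbb /tri_arc; case: (val u) => a b.
by rewrite (ltn_eqF (ltnSn a)) (ltn_eqF (ltnSn b)) !andbF.
Qed.

(* Main.v *)
(** Lower bound.  In one turn [l] lions clear at most [l] vertices and protect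
    at most [l] vertices of the inner boundary of the clean set, so the clean
    set can grow only while its inner boundary has fewer than [2 l] vertices.
    A set of vertices of the triangle with inner boundary of size [m], or its
    complement, has at most [m (m + 1) / 2] elements; this is shown by comparing
    consecutive columns.  Hence if [8 l ^ 2 <= n ^ 2] the clean set can never
    grow beyond [2 l ^ 2] vertices.

    Upper bound.  One lion per row advances along its row, each row being one
    turn behind the row below it, so that the region behind the lions is never
    recontaminated. *)

Require Import Defs.
From mathcomp Require Import all_boot all_order all_algebra.
From mathcomp Require Import reals zify.

Set Implicit Arguments.
Unset Strict Implicit.
Unset Printing Implicit Defensive.

Import GRing.Theory Num.Theory.

(** * Coordinates, columns and inner boundaries in the triangle *)

Section Coordinates.
Variable n : nat.
Implicit Types (A : {set tri_vertex n}) (u v : tri_vertex n).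

Definition abscissa v : nat := (val v).1.
Definition ordinate v : nat := (val v).2.

Lemma tri_vertex_leq v : abscissa v + ordinate v <= n.
Proof. exact: (valP v). Qed.

Lemma tri_vertex_inj u v :
  abscissa u = abscissa v -> ordinate u = ordinate v -> u = v.
Proof.
move=> eqx eqy; apply: val_inj; move: eqx eqy; rewrite /abscissa /ordinate.
by case: (val u) (val v) => [a b] [c d] /= /val_inj-> /val_inj->.
Qed.

Definition tri_origin : tri_vertex n := Sub (ord0, ord0) isT.

(* Off the triangle, [tri_point] takes a junk value. *)
Definition tri_point (x y : nat) : tri_vertex n :=
  insubd tri_origin (inord x, inord y).

Lemma tri_pointE x y : x + y <= n ->
  abscissa (tri_point x y) = x /\ ordinate (tri_point x y) = y.
Proof.
move=> le_xy; have [ltx lty] : x < n.+1 /\ y < n.+1 by lia.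
by rewrite /abscissa /ordinate /tri_point insubdK /= ?unfold_in /= !inordK.
Qed.

Lemma tri_pointK v : tri_point (abscissa v) (ordinate v) = v.
Proof.
by have [] := tri_pointE (tri_vertex_leq v); exact: tri_vertex_inj.
Qed.

Lemma tri_gridE u v : tri_grid u v =
  [|| (abscissa v == (abscissa u).+1) && (ordinate v == ordinate u),
      (abscissa v == abscissa u) && (ordinate v == (ordinate u).+1),
      (abscissa u == (abscissa v).+1) && (ordinate v == (ordinate u).+1),
      (abscissa u == (abscissa v).+1) && (ordinate u == ordinate v),
      (abscissa u == abscissa v) && (ordinate u == (ordinate v).+1)
    | (abscissa v == (abscissa u).+1) && (ordinate u == (ordinate v).+1)].
Proof.
rewrite /tri_grid /tri_arc /abscissa /ordinate.
by case: (val u) (val v) => [a b] [c d] /=; rewrite !orbA.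
Qed.

(** Ordinates are kept as plain numbers so that neighbouring columns can be compared by inclusion
    and by injections. *)
Definition column A (x : nat) : seq nat :=
  [seq y <- iota 0 (n.+1 - x) | tri_point x y \in A].

Lemma mem_column A x y :
  (y \in column A x) = (y < n.+1 - x) && (tri_point x y \in A).
Proof. by rewrite mem_filter mem_iota andbC. Qed.

Lemma column_uniq A x : uniq (column A x).
Proof. exact/filter_uniq/iota_uniq. Qed.

Lemma card_columns A : #|A| = \sum_(0 <= x < n.+1) size (column A x).
Proof.
rewrite -sum1_card (partition_big (fun v => (val v).1) predT) //= big_mkord.
apply: eq_bigr => x _; rewrite sum1dep_card.
rewrite -(size_map (tri_point x)); set s := map _ _.
have us : uniq s.
  rewrite map_inj_in_uniq ?column_uniq // => y z.
  rewrite !mem_column => /andP[lty _] /andP[ltz _] eq_yz.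
  have [_ <-] := @tri_pointE x y ltac:(lia).
  by rewrite eq_yz; have [] := @tri_pointE x z ltac:(lia).
rewrite -(card_uniqP us); apply: eq_card => v; rewrite !inE.
apply/andP/mapP => [[vA /eqP eqx]|[y]].
  exists (ordinate v); rewrite -?eqx ?tri_pointK // mem_column.
  by rewrite -[nat_of_ord _]/(abscissa v) tri_pointK vA; have := tri_vertex_leq v; lia.
rewrite mem_column => /andP[lty yA] ->; split=> //; apply/eqP/val_inj.
by have [] := @tri_pointE x y ltac:(lia).
Qed.

Lemma size_columnC A x :
  size (column A x) + size (column (~: A) x) = n.+1 - x.
Proof.
rewrite !size_filter -[RHS](size_iota 0).
rewrite -(count_predC (fun y => tri_point x y \in A)).
by congr (_ + _); apply: eq_count => y; rewrite /= inE.
Qed.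

Definition inner_boundary A : {set tri_vertex n} :=
  [set v in A | [exists u, (u \notin A) && tri_grid u v]].

Lemma boundary_columnD A x : size (column A x) =
  size (column (inner_boundary A) x) + size (column (A :\: inner_boundary A) x).
Proof.
rewrite !size_filter -(count_predUI _ _ (iota 0 _)) -[LHS]addn0; congr (_ + _).
  by apply: eq_count => y /=; rewrite !inE; case: (_ \in A) => //=; case: [exists _, _].
apply/esym/eqP; rewrite -leqn0 leqNgt -has_count; apply/hasPn => y _ /=.
by rewrite !inE andbA; case: ([exists _, _]); case: (_ \in A).
Qed.

(** The disjuncts are those of [tri_gridE] with (x', y') for [u] and (x, y) for [v]. *)
Lemma interior_nbr A x y x' y' :
  y \in column (A :\: inner_boundary A) x -> x + y <= n -> x' + y' <= n ->
  [|| (x == x'.+1) && (y == y'), (x == x') && (y == y'.+1),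
      (x' == x.+1) && (y == y'.+1), (x' == x.+1) && (y' == y),
      (x' == x) && (y' == y.+1) | (x == x'.+1) && (y' == y.+1)] ->
  y' \in column A x'.
Proof.
rewrite !mem_column !inE => /andP[_ /andP[nb yA]] lexy lexy' adj.
have [e1 e2] := tri_pointE lexy; have [e1' e2'] := tri_pointE lexy'.
apply/andP; split; first lia.
move: nb; rewrite yA /=; apply: contraR => nA; apply/existsP.
exists (tri_point x' y'); rewrite nA tri_gridE e1 e2 e1' e2' /=; exact: adj.
Qed.

(** Without boundary in the column, membership spreads from one cell up and down to the whole
    column. *)
Lemma boundary_column_gt0 A x : x <= n ->
  0 < size (column A x) < n.+1 - x -> 0 < size (column (inner_boundary A) x).
Proof.
move=> lex /andP[]; rewrite -{1}has_predT => /hasP[y0 y0A _].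
rewrite ltnNge; apply: contraR; rewrite -leqNgt leqn0 => /eqP b0.
have sub y : y \in column A x -> y \in column (A :\: inner_boundary A) x.
  move=> yA; have := mem_column (inner_boundary A) x y.
  move/size0nil: b0 => -> /esym; move: yA; rewrite in_nil !mem_column !inE.
  by move=> /andP[-> ->] /= ->.
have lt0 : y0 < n.+1 - x by move: y0A; rewrite mem_column => /andP[].
have up k : y0 + k < n.+1 - x -> y0 + k \in column A x.
  elim: k => [|k IH] ltk; first by rewrite addn0.
  by apply: (interior_nbr (sub _ (IH ltac:(lia)))); lia.
have down k : k <= y0 -> y0 - k \in column A x.
  elim: k => [|k IH] lek; first by rewrite subn0.
  by apply: (interior_nbr (sub _ (IH ltac:(lia)))); lia.
rewrite -[leqLHS](size_iota 0); apply: uniq_leq_size; first exact: iota_uniq.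
move=> y; rewrite mem_iota => /andP[_ lty].
case: (leqP y y0) => cy; first by rewrite -(subKn cy); apply: down; lia.
by rewrite -(subnKC (ltnW cy)); apply: up; lia.
Qed.

Lemma interior_column_le_next A x : x < n ->
  size (column A x.+1) < n - x ->
  size (column (A :\: inner_boundary A) x) <= size (column A x.+1).
Proof.
move=> ltx ltA.
have [y0 lty0 y0A] : exists2 y, y < n - x & y \notin column A x.+1.
  have : ~~ all (mem (column A x.+1)) (iota 0 (n - x)).
    apply/negP => /allP sub; move: ltA; rewrite ltnNge.
    by rewrite -{1}(size_iota 0 (n - x)) uniq_leq_size // iota_uniq.
  by case/allPn => y; rewrite mem_iota => /andP[_ lty] nA; exists y.
(* Since [y0] is missing from the next column, [y0] and [y0 + 1] are not
   interior, so collapsing them gives an injection into that column. *)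
pose f y := if y < y0 then y else y.-1.
have skip y : y \in column (A :\: inner_boundary A) x -> (y < y0) || (y0.+1 < y).
  move=> yI; have lty : y < n.+1 - x by move: yI; rewrite mem_column => /andP[].
  apply: contraR y0A => ncase; apply: (interior_nbr yI); lia.
rewrite -(size_map f); apply: uniq_leq_size.
  rewrite map_inj_in_uniq ?column_uniq // => y z /skip sy /skip sz.
  by rewrite /f; case: ifP; case: ifP; lia.
move=> _ /mapP[y yI ->].
have lty : y < n.+1 - x by move: yI; rewrite mem_column => /andP[].
by have := skip y yI; rewrite /f; case: ifP => cy sy; apply: (interior_nbr yI); lia.
Qed.

Lemma interior_column_prev A x :
  {subset column (A :\: inner_boundary A) x.+1 <= column A x}.
Proof.
move=> y yI; have lty : y < n.+1 - x.+1 by move: yI; rewrite mem_column => /andP[].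
by apply: (interior_nbr yI); lia.
Qed.

(** Equal sizes would make the two columns equal. As (x + 1, y) is adjacent to (x, y + 1), the
    common column would then be closed under successor and leave the triangle. *)
Lemma interior_column_lt_prev A x : 0 < size (column A x) ->
  size (column (A :\: inner_boundary A) x.+1) < size (column A x).
Proof.
move=> hA; set I := column _ x.+1.
have [->//|] := posnP (size I); rewrite -has_predT => /hasP[y0 y0I _].
rewrite ltnNge; apply/negP => leI.
have [_ eqI] := uniq_min_size (column_uniq _ _) (@interior_column_prev A x) leI.
have lt_I y : y \in I -> y < n - x.
  by rewrite mem_column => /andP[]; lia.
have climb k : y0 + k \in I.
  elim: k => [|k IH]; first by rewrite addn0.
  by rewrite eqI; have := lt_I _ IH => ?; apply: (interior_nbr IH); lia.
by have := lt_I _ (climb n); lia.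
Qed.

End Coordinates.

(** * Isoperimetry from column sizes *)

(** Induction step from the suffix starting at a column of height [s] to the one starting a column
    earlier. Indices 0 and 1 mark the added column and its successor; [B], [H], [G] total the
    boundary, cells and gaps beyond both. *)
Lemma column_profile_step (s h0 h1 b0 b1 B H G : nat) :
  0 < s -> h0 <= s.+1 -> h1 <= s -> 2 * (H + G) = s * s.-1 ->
  (0 < h0 < s.+1 -> 0 < b0) -> (h1 < s -> h0 <= h1 + b0) ->
  h1 <= h0 + b1 -> (0 < h0 -> h1 < h0 + b1) ->
  (h1 <= b1 + B /\ 2 * (h1 + H) <= (b1 + B) * (b1 + B).+1) \/
  (s - h1 <= B /\ 2 * (s - h1 + G) <= (b1 + B) * (b1 + B).+1) ->
  (h0 <= b0 + (b1 + B) /\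
     2 * (h0 + (h1 + H)) <= (b0 + (b1 + B)) * (b0 + (b1 + B)).+1) \/
  (s.+1 - h0 <= b1 + B /\
     2 * (s.+1 - h0 + (s - h1 + G)) <= (b0 + (b1 + B)) * (b0 + (b1 + B)).+1).
Proof.
move=> s_gt0 h0_le h1_le HG b_gt0 drop rise rise_lt.
have mono a b : a <= b -> a * a.+1 <= b * b.+1 by move=> ?; apply: leq_mul.
(* New boundary [k] > 0 pays for a column of up to [k + a] cells or gaps. *)
have incr a k : 0 < k -> a * a.+1 + 2 * (k + a) <= (k + a) * (k + a).+1 by nia.
set X := b1 + B.
have caseH : h1 < s -> h1 <= X -> 2 * (h1 + H) <= X * X.+1 ->
    h0 <= b0 + X /\ 2 * (h0 + (h1 + H)) <= (b0 + X) * (b0 + X).+1.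
  move=> lt1 le1 leH; split; first by have := drop lt1; lia.
  have [h00|h0_gt0] := posnP h0; first by have := mono X (b0 + X) ltac:(lia); lia.
  have := incr X b0 ltac:(lia); lia.
have caseG : 0 < h1 -> s - h1 <= B -> 2 * (s - h1 + G) <= X * X.+1 ->
    (h0 <= b0 + X /\ 2 * (h0 + (h1 + H)) <= (b0 + X) * (b0 + X).+1) \/
    (s.+1 - h0 <= X /\
       2 * (s.+1 - h0 + (s - h1 + G)) <= (b0 + X) * (b0 + X).+1).
  (* If [h0] is 0 then [rise] gives [h1 <= b1], so [s <= X] and all s (s + 1) / 2 later cells fit
     the bound. Otherwise [rise_lt] is strict, which makes up for the added column being one cell
     taller. *)
  move=> gt1 le1 leG; have [h00|h0_gt0] := posnP h0.
    left; split; first lia.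
    have := mono s (b0 + X) ltac:(lia); nia.
  right; split; first lia.
  have [eq0|neq0] := posnP (s.+1 - h0).
    by have := mono X (b0 + X) ltac:(lia); lia.
  have := incr X b0 ltac:(lia); lia.
(* The regime changes only at a full or empty column [h1]. Then [s <= X], and the columns beyond it
   hold only s (s - 1) / 2 positions. *)
have pred_le a : s.-1 <= a -> s * s.-1 <= a * a.+1.
  by move=> le_a; rewrite mulnC; have := mono _ _ le_a; rewrite prednK.
case=> [[le1 leH]|[le1 leG]].
  have [lt1|ge1] := ltnP h1 s; first by left; exact: caseH.
  by apply: caseG; [lia..|]; have := pred_le X ltac:(lia); lia.
have [h10|h1_gt0] := posnP h1; last exact: caseG.
by left; apply: caseH; [lia..|]; have := pred_le X ltac:(lia); lia.
Qed.

(* [h] and [b] are the numbers of cells of a set and of its inner boundary in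
   each column. Going from the last column to the first, the suffix either has
   few cells or few gaps, and it can pass from one regime to the other only
   when its boundary is at least as large as the side of the suffix. *)
Lemma column_profile_isoperimetry (n : nat) (h b : nat -> nat) :
  (forall c, c <= n -> h c <= n.+1 - c) ->
  (forall c, c <= n -> 0 < h c < n.+1 - c -> 0 < b c) ->
  (forall c, c < n -> h c.+1 < n - c -> h c <= h c.+1 + b c) ->
  (forall c, c < n -> h c.+1 <= h c + b c.+1) ->
  (forall c, c < n -> 0 < h c -> h c.+1 < h c + b c.+1) ->
  let m := \sum_(0 <= c < n.+1) b c in
  2 * \sum_(0 <= c < n.+1) h c <= m * m.+1 \/
  2 * \sum_(0 <= c < n.+1) (n.+1 - c - h c) <= m * m.+1.
Proof.
move=> h_le b_gt0 drop rise rise_lt.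
pose B c := \sum_(c <= i < n.+1) b i.
pose H c := \sum_(c <= i < n.+1) h i.
pose G c := \sum_(c <= i < n.+1) (n.+1 - i - h i).
have BS c : c <= n -> B c = b c + B c.+1 by move=> ?; rewrite /B big_ltn.
have HS c : c <= n -> H c = h c + H c.+1 by move=> ?; rewrite /H big_ltn.
have GS c : c <= n -> G c = n.+1 - c - h c + G c.+1 by move=> ?; rewrite /G big_ltn.
have HG k : k <= n.+1 -> 2 * (H (n.+1 - k) + G (n.+1 - k)) = k * k.+1.
  elim: k => [|k IH] lek; first by rewrite subn0 /H /G !big_geq.
  have le_c : n.+1 - k.+1 <= n by lia.
  have := IH ltac:(lia); rewrite (HS _ le_c) (GS _ le_c).
  have -> : (n.+1 - k.+1).+1 = n.+1 - k by lia.
  have := h_le (n.+1 - k.+1) ltac:(lia).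
  set h' := h _; set H' := H _; set G' := G _; nia.
(* Gaps are measured against [B c.+1], not [B c]: passing to the preceding column, their increase is
   paid by the boundary of the later column, that of the cells by the boundary of the earlier
   one. *)
suff: forall k, k <= n -> let c := n - k in
  (h c <= B c /\ 2 * H c <= B c * (B c).+1) \/
  (n.+1 - c - h c <= B c.+1 /\ 2 * G c <= B c * (B c).+1).
  by move/(_ n (leqnn n)); rewrite subnn => -[[_ ?]|[_ ?]]; [left|right].
elim=> [|k IH] lek c.
  have ec : c = n by rewrite /c subn0.
  have := h_le n (leqnn n).
  have H0 : H n.+1 = 0 by rewrite /H big_geq.
  have G0 : G n.+1 = 0 by rewrite /G big_geq.
  rewrite ec HS // GS // H0 G0.
  case: (h n) => [|[|?]]; last lia.
    by left; split; lia.
  by right; split; lia.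
have {IH} := IH ltac:(lia).
have <- : c.+1 = n - k by rewrite /c; lia.
move=> /=.
have ltc : c < n by rewrite /c; lia.
have HG2 := HG k ltac:(lia).
have lec := ltnW ltc.
rewrite (BS _ lec) (HS _ lec) (GS _ lec) (BS _ ltc) (HS _ ltc) (GS _ ltc).
have -> : n.+1 - c = (n - c).+1 by lia.
have -> : n.+1 - c.+1 = n - c by lia.
apply: column_profile_step; first lia.
- by have := h_le c ltac:(lia); lia.
- by have := h_le c.+1 ltac:(lia); lia.
- have -> : c.+2 = n.+1 - k by rewrite /c; lia.
  by rewrite HG2; have -> : n - c = k.+1; rewrite /c; lia.
- by move=> ?; apply: b_gt0; lia.
- exact: drop.
- exact: rise.
- exact: rise_lt.
Qed.

Lemma sum_triangle n : 2 * \sum_(0 <= c < n.+1) (n.+1 - c) = n.+1 * n.+2.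
Proof.
elim: n => [|n IH]; first by rewrite big_nat1.
by rewrite big_nat_recl // mulnDr IH; lia.
Qed.

Lemma card_tri_vertex n : 2 * #|tri_vertex n| = n.+1 * n.+2.
Proof.
rewrite -sum_triangle -cardsT card_columns; congr (2 * _).
apply: eq_bigr => x _; rewrite /column -[RHS](size_iota 0); congr size.
by apply/all_filterP/allP => y _; rewrite inE.
Qed.

Lemma inner_boundary_isoperimetry n (A : {set tri_vertex n}) :
  let m := #|inner_boundary A| in
  2 * #|A| <= m * m.+1 \/ 2 * #|~: A| <= m * m.+1.
Proof.
rewrite !card_columns.
have -> : \sum_(0 <= x < n.+1) size (column (~: A) x) =
          \sum_(0 <= x < n.+1) (n.+1 - x - size (column A x)).
  by apply: eq_bigr => x _; rewrite -(size_columnC A) addKn.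
apply: column_profile_isoperimetry => x lex.
- by rewrite -(size_columnC A) leq_addr.
- exact: boundary_column_gt0.
- move=> /(interior_column_le_next lex); rewrite (boundary_columnD A x); lia.
- have := uniq_leq_size (column_uniq _ _) (@interior_column_prev n A x).
  by rewrite (boundary_columnD A x.+1) addnC leq_add2r.
- by move/interior_column_lt_prev; rewrite (boundary_columnD A x.+1); lia.
Qed.

(** * Growth of the clean set in one turn *)

Section OneTurn.
Variables (V : finType) (adj : rel V) (l : nat) (p q : placement V l).
Variable C : {set V}.

Lemma card_occupied (r : placement V l) : #|occupied r| <= l.
Proof.
rewrite -[leqRHS]card_ord; apply: leq_trans (leq_imset_card r 'I_l).
apply/subset_leq_card/subsetP => v; rewrite inE => /existsP[i /eqP <-].
exact: imset_f.
Qed.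

Lemma card_cleared_le : #|~: spread adj p q C :\: ~: C| <= l.
Proof.
apply: leq_trans (card_occupied q); apply/subset_leq_card/subsetP => v.
rewrite !inE negbK => /andP[vC]; rewrite vC andbT negbK; exact.
Qed.

(* A lion entering a contaminated vertex protects the vertex it leaves; any
   other lion protects only the vertex it reaches. *)
Lemma card_protected_le :
  #|[set v in ~: C | [exists u, (u \in C) && adj u v]] :&: ~: spread adj p q C|
    <= l.
Proof.
pose guarded i := if q i \in C then p i else q i.
rewrite -[leqRHS]card_ord; apply: leq_trans (leq_imset_card guarded 'I_l).
apply/subset_leq_card/subsetP => v; rewrite !inE => /andP[/andP[vC]].
case/existsP=> u /andP[uC uv]; rewrite negb_and negbK => /orP[/existsP[i /eqP qi]|].
  by apply/imsetP; exists i => //; rewrite /guarded qi (negPf vC).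
rewrite negb_or => /andP[_]; rewrite negb_exists => /forallP/(_ u).
rewrite uv uC /= negbK => /existsP[i]; case/orP=> /andP[/eqP pi /eqP qi].
  by apply/imsetP; exists i => //; rewrite /guarded qi (negPf vC).
by apply/imsetP; exists i => //; rewrite /guarded qi uC pi.
Qed.

(** Inside the old clean set, the vertices that stay clean and the inner boundary overlap in at most
    [l] protected vertices; at most [l] further vertices are newly cleared. *)
Lemma card_clean_growth :
  #|~: spread adj p q C| + #|[set v in ~: C | [exists u, (u \in C) && adj u v]]|
    <= #|~: C| + 2 * l.
Proof.
set D' := ~: spread _ _ _ _; set bd := [set v in _ | _].
have := card_cleared_le; have := card_protected_le; rewrite -/D' -/bd.
have sub_bd : bd \subset ~: C by apply/subsetP => v; rewrite inE => /andP[].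
have : #|D' :&: ~: C :|: bd| <= #|~: C|.
  by rewrite subset_leq_card // subUset subsetIr sub_bd.
rewrite cardsU -setIA (setIidPr sub_bd) [D' :&: bd]setIC.
have := cardsID (~: C) D'.
have : #|bd :&: D'| <= #|bd| by rewrite subset_leq_card ?subsetIl.
lia.
Qed.
End OneTurn.

(** * The bound on the clean set is invariant *)

Lemma spread_card_clean_le n l (p q : placement (tri_vertex n) l) C :
  8 * l ^ 2 <= n ^ 2 -> #|~: C| <= 2 * l ^ 2 ->
  #|~: spread (@tri_grid n) p q C| <= 2 * l ^ 2.
Proof.
move=> le_ln leC; have := card_clean_growth (@tri_grid n) p q C.
have -> : [set v in ~: C | [exists u, (u \in C) && tri_grid u v]] =
          inner_boundary (~: C).
  by apply/setP => v; rewrite !inE; congr (_ && _); apply: eq_existsb => u; rewrite inE negbK.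
have gain : #|~: spread (@tri_grid n) p q C| <= #|~: C| + l.
  rewrite -(cardsID (~: C)) leq_add ?card_cleared_le //.
  by rewrite subset_leq_card ?subsetIr.
have := inner_boundary_isoperimetry (~: C); rewrite setCK /=.
have := cardsC C; have := card_tri_vertex n.
move: #|tri_vertex n| #|C| #|~: C| #|inner_boundary _| #|~: spread _ _ _ _| gain leC.
move=> N c d m d' gain leC eqN eqc iso growth.
rewrite leqNgt; apply/negP => gtd.
have lt_m : m < 2 * l by lia.
have : m * m.+1 <= (2 * l).-1 * (2 * l) by apply: leq_mul; lia.
(* Either [d] is at most 2 l^2 - l, and [gain] contradicts [gtd]; or [c] is, and then [N] is at most
   4 l^2 - l, whereas 2 N = (n + 1) (n + 2) > 8 l^2. *)
case: iso; nia.
Qed.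

Lemma lions_win_lt n l : lions_win (@tri_grid n) l -> n ^ 2 < 8 * l ^ 2.
Proof.
case=> p [moves [_ win]]; rewrite ltnNge; apply/negP => le_ln.
suff: #|~: contamination_after (@tri_grid n) p (initial_contamination p) moves|
        <= 2 * l ^ 2.
  by rewrite win setC0 cardsT; have := card_tri_vertex n; nia.
have : #|~: initial_contamination p| <= 2 * l ^ 2.
  by rewrite setCK; apply: leq_trans (card_occupied p) _; nia.
elim: moves p (initial_contamination p) {win} => //= q moves IH p C leC.
exact/IH/spread_card_clean_le.
Qed.

(** * The sweeping strategy with n + 1 lions *)

Section Sweep.
Variable n : nat.

(* Lion [y] stays in row [y] and waits for the lion below it: [(t - y)./2] makes
   row [y + 1] reproduce row [y] one turn later. *)
Definition sweep_front (t y : nat) : nat := minn (n - y) (t - y)./2.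

Definition sweep (t : nat) : placement (tri_vertex n) n.+1 :=
  [ffun i : 'I_n.+1 => tri_point n (sweep_front t i) i].

Definition unswept (t : nat) : {set tri_vertex n} :=
  [set v | sweep_front t (ordinate v) < abscissa v].

Lemma sweep_pointE t y : y <= n ->
  abscissa (tri_point n (sweep_front t y) y) = sweep_front t y /\
  ordinate (tri_point n (sweep_front t y) y) = y.
Proof. by move=> ley; apply: tri_pointE; rewrite /sweep_front; lia. Qed.

Lemma occupied_sweep t (v : tri_vertex n) :
  abscissa v = sweep_front t (ordinate v) -> v \in occupied (sweep t).
Proof.
move=> eqv; have lev := tri_vertex_leq v.
have lty : ordinate v < n.+1 by lia.
rewrite inE; apply/existsP; exists (Ordinal lty); rewrite ffunE /=.
by rewrite -eqv tri_pointK.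
Qed.

Lemma sweep_legal t : legal_turn (@tri_grid n) (sweep t) (sweep t.+1).
Proof.
apply/forallP => i; rewrite !ffunE.
have lei : i <= n by rewrite -ltnS.
have [ex ey] := sweep_pointE t lei; have [ex' ey'] := sweep_pointE t.+1 lei.
have [eqf|neqf] := eqVneq (sweep_front t.+1 i) (sweep_front t i).
  by rewrite eqf eqxx.
apply/orP; right; rewrite tri_gridE ex ey ex' ey' eqxx andbT.
by apply/orP; left; move: neqf; rewrite /sweep_front; lia.
Qed.

(** The delay between rows rules out recontamination from the rows above and below. The only
    remaining threat to a vertex behind the new front comes from its right neighbour, along the edge
    that the lion of that row is just traversing. *)
Lemma spread_sweep t (C : {set tri_vertex n}) : C \subset unswept t ->
  spread (@tri_grid n) (sweep t) (sweep t.+1) C \subset unswept t.+1.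
Proof.
move=> /subsetP subC; apply/subsetP => v; rewrite !inE => /andP[nocc].
have lev := tri_vertex_leq v.
have neqv : abscissa v != sweep_front t.+1 (ordinate v).
  by apply: contra nocc => /eqP /occupied_sweep; rewrite inE.
case/orP=> [/subC|/existsP[u /and3P[uv /subC uC ntr]]].
  by rewrite inE; move: neqv; rewrite /sweep_front; lia.
rewrite ltnNge; apply/negP => lev'.
have lty : ordinate v < n.+1 by lia.
have leu := tri_vertex_leq u.
move: uC; rewrite inE => uC.
have [eqy eqx] : ordinate u = ordinate v /\ abscissa u = (abscissa v).+1.
  move: uv uC neqv lev'; rewrite tri_gridE /sweep_front; lia.
case/negP: ntr; apply/existsP; exists (Ordinal lty); rewrite !ffunE /=.
apply/orP; right; apply/andP; split; apply/eqP.
  rewrite -[RHS]tri_pointK; congr tri_point.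
  by move: uC neqv lev'; rewrite /sweep_front; lia.
rewrite -[RHS]tri_pointK eqy; congr tri_point.
by move: uC neqv lev'; rewrite /sweep_front; lia.
Qed.

Lemma contamination_after_sweep k t (C : {set tri_vertex n}) :
  C \subset unswept t ->
  contamination_after (@tri_grid n) (sweep t) C (map sweep (iota t.+1 k))
    \subset unswept (t + k).
Proof.
elim: k t C => [|k IH] t C subC /=; first by rewrite addn0.
by rewrite addnS -addSn; apply/IH/spread_sweep.
Qed.

Lemma path_sweep k t :
  path (@legal_turn _ (@tri_grid n) n.+1) (sweep t) (map sweep (iota t.+1 k)).
Proof. by elim: k t => [|k IH] t //=; rewrite sweep_legal IH. Qed.

Lemma lions_win_sweep : lions_win (@tri_grid n) n.+1.
Proof.
(* Row y is finished at time 2 n - y, so the bottom row is the last, at time 2 n. *)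
exists (sweep 0), (map sweep (iota 1 n.*2)); split; first exact: path_sweep.
apply/eqP; rewrite -subset0.
have init : initial_contamination (sweep 0) \subset unswept 0.
  apply/subsetP => v; rewrite in_setC; apply: contraR; rewrite inE -leqNgt => lev.
  by apply: occupied_sweep; move: lev; rewrite /sweep_front; lia.
apply: subset_trans (contamination_after_sweep _ init) _.
apply/subsetP => v; rewrite !inE /sweep_front; have := tri_vertex_leq v; lia.
Qed.
End Sweep.

(** * Both bounds on the lion number *)

Local Open Scope ring_scope.

Theorem theorem3 (R : realType) (n : nat) (hn : (0 < n)%N) :
  n%:R / (2 * Num.sqrt 2) < (lion_number (@tri_grid n))%:R :> R
  /\ (lion_number (@tri_grid n) <= n + 1)%N.
Proof.
have [wins minl] := lion_numberP (@tri_grid n).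
split; last by rewrite addn1; apply/minl/lions_win_sweep.
move: wins => /lions_win_lt; set l := lion_number _ => lt_nl.
have s_gt0 : 0 < 2 * Num.sqrt 2 :> R by rewrite mulr_gt0 // sqrtr_gt0.
(* Both sides are nonnegative, so their squares are compared; the square of 2 sqrt 2 is the 8 of
   [lions_win_lt]. *)
rewrite ltr_pdivrMr // -(@ltr_pXn2r _ 2) ?nnegrE ?mulr_ge0 // ?ler0n ?sqrtr_ge0 //.
rewrite !exprMn sqr_sqrtr // -!natrX -!natrM ltr_nat.
lia.
Qed.
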